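(* Let $F,G:\mathbf{Sets}\to\mathbf{Sets}$ be functors, $\alpha:F\Rightarrow G$ a natural transformation and $\sqsubseteq_F$ an order on $F$. If $R\subseteq X\times Y$ is a $\sqsubseteq_F$-simulation between $a:X\to FX$ and $b:Y\to FY$, then $R$ is a $\sqsubseteq_F^\alpha$-simulation between $a'=\alpha_X\circ a$ and $b'=\alpha_Y\circ b$.
   Context: An order on a functor $F$ is a family of preorders $\sqsubseteq_X\subseteq FX\times FX$ such that for all $f:X\to Y$, $u\sqsubseteq_X u'$ implies $Ff(u)\sqsubseteq_Y Ff(u')$. For $R\subseteq X\times Y$ with projections $r_1,r_2$, $R$ is a $\sqsubseteq$-simulation between coalgebras $c:X\to FX$, $d:Y\to FY$ if for all $(x,y)\in R$ there is $w\in FR$ with $c(x)\sqsubseteq Fr_1(w)$ and $Fr_2(w)\sqsubseteq d(y)$. A natural transformation $\alpha:F\Rightarrow G$ is a family $\alpha_X:FX\to GX$ with $Gf\circ\alpha_X=\alpha_Y\circ Ff$. The projected order $\sqsubseteq_F^\alpha$ on $G$ is, for each $X$, the transitive closure of the relation on $GX$ relating $x$ and $x'$ iff either $x=x'$, or there exist $x_1,x_1'\in FX$ with $x=\alpha_X(x_1)$, $x'=\alpha_X(x_1')$ and $x_1\sqsubseteq_F x_1'$. *)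

(* Defs.v *)
From Stdlib Require Export Basics Relations.
Open Scope program_scope.

(* Naming the universe makes [Sets -> Sets] below an endofunctor on one fixed
   category of types and functions. *)
Definition Sets := Type.

(* The laws are equations between functions, as in the category of sets. *)
Record functor : Type := Functor {
  fobj :> Sets -> Sets;
  fmap : forall X Y : Sets, (X -> Y) -> fobj X -> fobj Y;
  fmap_id : forall X : Sets, fmap X X (fun x => x) = (fun u => u);
  fmap_comp : forall (X Y Z : Sets) (f : X -> Y) (g : Y -> Z),
      fmap X Z (g ∘ f) = fmap Y Z g ∘ fmap X Y f
}.
Arguments fmap F {X Y} f u : rename.

Record nat_trans (F G : functor) : Type := NatTrans {
  component :> forall X : Sets, F X -> G X;
  naturality : forall (X Y : Sets) (f : X -> Y),
      fmap G f ∘ component X = component Y ∘ fmap F f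
}.
Arguments component {F G} alpha X u : rename.

Record functor_order (F : functor) : Type := Order {
  order_rel :> forall X : Sets, relation (F X);
  order_preorder : forall X : Sets, preorder (F X) (order_rel X);
  order_fmap : forall (X Y : Sets) (f : X -> Y) (u u' : F X),
      order_rel X u u' -> order_rel Y (fmap F f u) (fmap F f u')
}.
Arguments order_rel {F} le X u u' : rename.

(* A relation R, a subset of X * Y, viewed as an object of [Sets]. *)
Definition graph {X Y : Sets} (R : X -> Y -> Prop) : Sets :=
  {p : X * Y | R (fst p) (snd p)}.
Definition proj_l {X Y : Sets} (R : X -> Y -> Prop) (p : graph R) : X :=
  fst (proj1_sig p).
Definition proj_r {X Y : Sets} (R : X -> Y -> Prop) (p : graph R) : Y :=
  snd (proj1_sig p).

Definition simulation {F : functor} (le : functor_order F) {X Y : Sets}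
    (c : X -> F X) (d : Y -> F Y) (R : X -> Y -> Prop) : Prop :=
  forall (x : X) (y : Y), R x y ->
    exists w : F (graph R),
      le X (c x) (fmap F (proj_l R) w) /\ le Y (fmap F (proj_r R) w) (d y).

Definition projected_step {F G : functor} (alpha : nat_trans F G)
    (le : functor_order F) (X : Sets) : relation (G X) :=
  fun x x' => x = x' \/
    exists x1 x1' : F X, x = alpha X x1 /\ x' = alpha X x1' /\ le X x1 x1'.

Definition projected_rel {F G : functor} (alpha : nat_trans F G)
    (le : functor_order F) (X : Sets) : relation (G X) :=
  clos_trans (G X) (projected_step alpha le X).

Lemma projected_preorder {F G : functor} (alpha : nat_trans F G)
    (le : functor_order F) (X : Sets) : preorder (G X) (projected_rel alpha le X).
Proof.
split.
- intro u; apply t_step; left; reflexivity.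
- intros u v w; apply t_trans.
Qed.

Lemma projected_fmap {F G : functor} (alpha : nat_trans F G) (le : functor_order F)
    (X Y : Sets) (f : X -> Y) (u u' : G X) :
  projected_rel alpha le X u u' ->
  projected_rel alpha le Y (fmap G f u) (fmap G f u').
Proof.
induction 1 as [u u' H | u v w _ IH1 _ IH2]; [| exact (t_trans _ _ _ _ _ IH1 IH2)].
apply t_step; destruct H as [-> | (x & x' & -> & -> & H)]; [now left | right].
assert (E : forall z, fmap G f (alpha X z) = alpha Y (fmap F f z))
  by exact (fun z => f_equal (fun h => h z) (naturality F G alpha X Y f)).
exists (fmap F f x), (fmap F f x'); rewrite !E; repeat split.
now apply order_fmap.
Qed.

Definition projected_order {F G : functor} (alpha : nat_trans F G)
    (le : functor_order F) : functor_order G :=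
  Order G (projected_rel alpha le) (projected_preorder alpha le)
    (projected_fmap alpha le).

(* Main.v *)
Require Import Defs.

(** Simulation witnesses are transported along [alpha]: naturality carries the projections of a
    witness to those of its image, and [alpha] is monotone from [le] to the projected order. *)

Lemma naturality_apply {F G : functor} (alpha : nat_trans F G) (X Y : Sets)
    (f : X -> Y) (u : F X) :
  fmap G f (alpha X u) = alpha Y (fmap F f u).
Proof.
exact (f_equal (fun h => h u) (naturality F G alpha X Y f)).
Qed.

(** A single generating step of the closure relates the two images. *)
Lemma projected_rel_component {F G : functor} (alpha : nat_trans F G)
    (le : functor_order F) (X : Sets) (u u' : F X) :
  le X u u' -> projected_rel alpha le X (alpha X u) (alpha X u').
Proof.
intro H; apply t_step; right; exists u, u'; auto.
Qed.

Theorem theorem3 (F G : functor) (alpha : nat_trans F G) (le : functor_order F)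
    (X Y : Sets) (a : X -> F X) (b : Y -> F Y) (R : X -> Y -> Prop)
    (hR : simulation le a b R) :
  simulation (projected_order alpha le) (alpha X ∘ a) (alpha Y ∘ b) R.
Proof.
intros x y Rxy; destruct (hR x y Rxy) as (w & Hl & Hr).
(* Naturality at [proj_l R] and [proj_r R] turns both goals into comparisons of [alpha]-images. *)
exists (alpha (graph R) w); rewrite !naturality_apply.
split; now apply projected_rel_component.
Qed.
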